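(* Let $k,r$ be integers with $k\ge r\ge1$. The set $\mathcal{M}_{k,r}$ of $(k,r)$-modulo overpartitions is a separable overpartition class with modulus $k$, and $\mathcal{B}_{k,r}=\bigcup_{m\ge1}\mathcal{B}_{k,r}(m)$ is its basis.
   Context: An overpartition is a partition in which the first occurrence of each part size may be overlined. Parts are ordered by $1<\bar1<2<\bar2<3<\cdots$ and written in non-increasing order. Convention: for a positive integer $t$ and non-negative integer $c$, $\bar t\pm c=\overline{t\pm c}$. A $(k,r)$-overpartition is an overpartition in which only parts congruent to $r$ mod $k$ may be overlined. For a part $\pi_i$, $\varphi_{k,r}(\pi_i)$ is the unique $s$ with $-k+r+1\le s\le r$ and $\pi_i\equiv s\pmod k$. A $(k,r)$-modulo overpartition is a $(k,r)$-overpartition $\pi=(\pi_1,\ldots,\pi_m)$ with (1) $\pi_m\equiv1,2,\ldots,r\pmod k$, and (2) for $1\le i<m$, if $\varphi_{k,r}(\pi_i)<\varphi_{k,r}(\pi_{i+1})$ then $\pi_{i+1}$ is overlined. A set $\mathcal{P}$ of overpartitions is a separable overpartition class with modulus $k$ if there is a subset $\mathcal{B}\subseteq\mathcal{P}$ (the basis) such that for each $m\ge1$: (1) the number of overpartitions in $\mathcal{B}$ with $m$ parts is finite; (2) every overpartition in $\mathcal{P}$ with $m$ parts is uniquely of the form $(\lambda_1+\mu_1,\ldots,\lambda_m+\mu_m)$ where $(\lambda_1,\ldots,\lambda_m)\in\mathcal{B}$ and $(\mu_1,\ldots,\mu_m)$ is a non-increasing sequence of non-negative integers each divisible by $k$;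 (3) all overpartitions of this form are in $\mathcal{P}$. For $m\ge1$, $\mathcal{B}_{k,r}(m)$ is the set of overpartitions $\lambda=(\lambda_1,\ldots,\lambda_m)$ such that: only parts congruent to $r$ mod $k$ may be overlined; $\lambda_m\le\bar r$; and for $1\le i<m$ and every integer $j\ge0$, if $\overline{k(j-1)+r}\le\lambda_{i+1}\le kj+r$ then $\lambda_i\le\overline{kj+r}$ (for $j=0$ the lower bound is vacuous, i.e. $\lambda_{i+1}\le r$ implies $\lambda_i\le\bar r$). *)

(* Defs.v *)
From mathcomp Require Import all_boot all_order all_algebra all_classical.
From mathcomp Require Import zify.

Set Implicit Arguments.
Unset Strict Implicit.
Unset Printing Implicit Defensive.

Import Order.TTheory GRing.Theory Num.Theory.

Local Open Scope nat_scope.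
Local Open Scope classical_set_scope.

(* A part is a size together with a flag telling whether it is overlined.  As
   false < true, the lexicographic order is 1 < \bar 1 < 2 < \bar 2 < ... *)
Definition part : Type := (nat *l bool)%type.

Definition plain_part (t : nat) : part := (t, false).
Definition over_part (t : nat) : part := (t, true).
Definition psize (p : part) : nat := p.1.
Definition overlined (p : part) : bool := p.2.

Lemma le_partE (p q : part) :
  (p <= q)%O = (psize p < psize q)
            || (psize p == psize q) && (overlined p ==> overlined q).
Proof.
case: p q => [t b] [u c]; rewrite /psize /overlined Order.ProdLexiOrder.leEprodlexi /=.
rewrite !leEnat; case: (ltngtP t u) => //= _.
by case: b c => [] [].
Qed.

(* The pairwise condition says that a part preceded by a part of the same size
   is not overlined. *)
Definition overpartition : set (seq part) :=
  [set s | [/\ all (fun p => 0 < psize p) s,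
               sorted (fun p q => (q <= p)%O) s
             & pairwise (fun p q => (psize p == psize q) ==> ~~ overlined q) s]].

Definition only_overlined (k r : nat) (s : seq part) : Prop :=
  forall p, p \in s -> overlined p -> psize p = r %[mod k].

Definition kr_overpartition (k r : nat) : set (seq part) :=
  [set s | overpartition s /\ only_overlined k r s].

Definition phi (k r : nat) (p : part) : int :=
  (r%:Z - ((r%:Z - (psize p)%:Z)%R %% k%:Z)%Z)%R.

Lemma phiP (k r : nat) (p : part) (s : int) : 0 < k ->
  (s = phi k r p) <->
  ((- k%:Z + r%:Z + 1 <= s <= r%:Z)%R /\ ((psize p)%:Z = s %[mod k%:Z])%Z).
Proof.
move=> k0; have kZ : (k%:Z != 0 :> int)%R by rewrite -lt0n.
have [c cE] : exists c : int,
    ((r%:Z - (psize p)%:Z)%R = (c * k%:Z + ((r%:Z - (psize p)%:Z)%R %% k%:Z)%Z)%R).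
  by exists ((r%:Z - (psize p)%:Z)%R %/ k%:Z)%Z; rewrite -divz_eq.
have lo := modz_ge0 (r%:Z - (psize p)%:Z)%R kZ.
have hi : (((r%:Z - (psize p)%:Z)%R %% k%:Z)%Z < k%:Z)%R by rewrite ltz_pmod.
split=> [->|[/andP[s1 s2] sE]].
  rewrite /phi; split; first by lia.
  have -> : (r%:Z - ((r%:Z - (psize p)%:Z)%R %% k%:Z)%Z = c * k%:Z + (psize p)%:Z)%R.
    by lia.
  by rewrite modzMDl.
have -> : s = (r%:Z - (r%:Z - s))%R by lia.
rewrite /phi; congr (_ - _)%R.
have <- : ((r%:Z - s)%R %% k%:Z)%Z = (r%:Z - s)%R by rewrite modz_small //; lia.
by rewrite -modzDmr -modzNm -sE modzNm modzDmr.
Qed.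

(* The empty overpartition belongs to this set: both conditions are vacuous for it. *)
Definition modulo_overpartition (k r : nat) : set (seq part) :=
  [set s | [/\ kr_overpartition k r s,
      0 < size s ->
        exists2 c, 1 <= c <= r & psize (last (plain_part 0) s) = c %[mod k]
    & forall i, i.+1 < size s ->
        (phi k r (nth (plain_part 0) s i) < phi k r (nth (plain_part 0) s i.+1))%R ->
        overlined (nth (plain_part 0) s i.+1)]].

Definition add_to_part (p : part) (c : nat) : part := (psize p + c, overlined p).

Definition add_to_parts (l : seq part) (mu : seq nat) : seq part :=
  [seq add_to_part pc.1 pc.2 | pc <- zip l mu].

Definition multiples (k m : nat) : set (seq nat) :=
  [set mu | [/\ size mu = m, sorted geq mu & all (dvdn k) mu]].

Definition is_basis (k : nat) (P B : set (seq part)) : Prop :=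
  B `<=` P /\
  forall m, 1 <= m ->
  [/\ finite_set [set l | B l /\ size l = m],
      forall s, P s -> size s = m ->
        exists! lmu : seq part * seq nat,
          [/\ B lmu.1, size lmu.1 = m, multiples k m lmu.2
            & s = add_to_parts lmu.1 lmu.2]
    & forall l mu, B l -> size l = m -> multiples k m mu ->
        P (add_to_parts l mu)].

Definition separable_overpartition_class (k : nat) (P : set (seq part)) : Prop :=
  P `<=` overpartition /\ exists B, is_basis k P B.

Definition modulo_basis_size (k r m : nat) : set (seq part) :=
  [set l | [/\ overpartition l,
      size l = m,
      only_overlined k r l,
      (last (plain_part 0) l <= over_part r)%O
    & forall i j, i.+1 < m ->
        (0 < j -> (over_part (k * j.-1 + r) <= nth (plain_part 0) l i.+1)%O) ->
        (nth (plain_part 0) l i.+1 <= plain_part (k * j + r))%O ->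
        (nth (plain_part 0) l i <= over_part (k * j + r))%O]].

Definition modulo_basis (k r : nat) : set (seq part) :=
  \bigcup_(m in [set m | 1 <= m]) modulo_basis_size k r m.

(* Main.v *)
Require Import Defs.
From mathcomp Require Import all_boot all_order all_algebra all_classical.
From mathcomp Require Import zify.

(** Write a part size as [k * u + s] with [s] its [phi]-value, and call [u] its
level.  In a modulo overpartition the level of a part exceeds the level of the
next part by at least [1] or [0], according to whether the next part is
overlined.  The basis elements are the modulo overpartitions whose last level
is [0] and in which this bound is attained everywhere, so that the level of
each part is the number of overlined parts after it.  Adding multiples of [k]
changes only the levels; hence the basis element under a modulo overpartition
is obtained by lowering each level to that number. *)

Set Implicit Arguments.
Unset Strict Implicit.
Unset Printing Implicit Defensive.

Import Order.TTheory GRing.Theory Num.Theory.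

Local Open Scope nat_scope.
Local Open Scope classical_set_scope.

(* The order of the parts, together with the rule that only a first occurrence
   may be overlined, is equivalent to this single inequality between
   consecutive parts. *)
Definition part_step (p q : part) : bool := psize q + overlined q <= psize p.

Lemma part_step_trans : transitive part_step.
Proof. by move=> q p s; rewrite /part_step; lia. Qed.

Lemma part_stepE (p q : part) :
  part_step p q =
  (q <= p)%O && ((psize p == psize q) ==> ~~ overlined q).
Proof.
rewrite le_partE /part_step; case: (overlined p); case: (overlined q) => /=; lia.
Qed.

Lemma overpartitionP (s : seq part) :
  overpartition s <-> all (fun p => 0 < psize p) s /\ sorted part_step s.
Proof.
split=> [[pos srt pw]|[pos st]].
  split=> //; apply/(sortedP (plain_part 0)) => i ilt.
  rewrite part_stepE (sortedP _ srt) //=.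
  by apply: (pairwiseP (plain_part 0) pw) => //; rewrite inE ltnW.
split=> //.
  by apply: sub_sorted st => p q; rewrite part_stepE => /andP[].
(* Transitivity of [part_step] carries the condition from consecutive pairs to all pairs. *)
move: st; rewrite (sorted_pairwise part_step_trans).
by apply: sub_pairwise => p q; rewrite part_stepE => /andP[].
Qed.

Lemma sorted_and (T : Type) (e1 e2 : rel T) (s : seq T) :
  sorted (fun p q => e1 p q && e2 p q) s = sorted e1 s && sorted e2 s.
Proof.
case: s => // x s /=.
by elim: s x => //= y s IHs x; rewrite IHs; case: (e1 x y); case: (e2 x y);
  rewrite ?andbF.
Qed.

Lemma add_to_parts_cons (p : part) (l : seq part) (c : nat) (mu : seq nat) :
  add_to_parts (p :: l) (c :: mu) = add_to_part p c :: add_to_parts l mu.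
Proof. by []. Qed.

Lemma count_overlined_add (l : seq part) (mu : seq nat) : size l = size mu ->
  count overlined (add_to_parts l mu) = count overlined l.
Proof.
by elim: l mu => [|p l IHl] [|c mu] //= [szE]; congr (_ + _); exact: IHl.
Qed.

(** * Levels and residues of part sizes *)

Section Levels.

Variables (k r : nat).
Hypotheses (hr : 1 <= r) (hkr : r <= k).

Let k_gt0 : 0 < k. Proof. exact: leq_trans hkr. Qed.

(* [phi k r p = residue p + r + 1 - k] when [psize p > 0]; the shift keeps
   everything in [nat]. *)
Definition level (p : part) : nat := (psize p + k - r.+1) %/ k.
Definition residue (p : part) : nat := (psize p + k - r.+1) %% k.

Lemma level_residue (p : part) : 0 < psize p ->
  psize p + k = k * level p + residue p + r.+1.
Proof.
move=> p0; have := divn_eq (psize p + k - r.+1) k.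
by rewrite /level /residue mulnC; lia.
Qed.

Lemma residue_lt (p : part) : residue p < k.
Proof. exact: ltn_pmod. Qed.

Lemma level_residue_unique (p : part) (u s : nat) : s < k ->
  psize p + k = k * u + s + r.+1 -> level p = u /\ residue p = s.
Proof.
move=> sk pE; rewrite /level /residue.
have -> : psize p + k - r.+1 = u * k + s by lia.
by rewrite divnMDl // modnMDl divn_small // modn_small // addn0.
Qed.

Lemma level_residue_add (p : part) (c : nat) : 0 < psize p ->
  level (add_to_part p (k * c)) = level p + c /\
  residue (add_to_part p (k * c)) = residue p.
Proof.
move=> p0; apply: level_residue_unique; first exact: residue_lt.
by have := level_residue p0; rewrite /= /psize /= => pE; nia.
Qed.

Lemma phi_residue (p : part) : 0 < psize p ->
  phi k r p = ((residue p)%:Z + r.+1%:Z - k%:Z)%R.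
Proof.
move=> p0; apply/esym/phiP => //.
have pE := level_residue p0; have sk := residue_lt p.
split; first by lia.
have -> : ((psize p)%:Z = (level p)%:Z * k%:Z
             + ((residue p)%:Z + r.+1%:Z - k%:Z))%R by nia.
by rewrite modzMDl.
Qed.

Lemma residue_overlined (p : part) : 0 < psize p ->
  (psize p = r %[mod k]) -> residue p = k.-1.
Proof.
move=> p0 /eqP pr; rewrite /residue.
have [rp|pr'] := leqP r (psize p).
  move: pr; rewrite eqn_mod_dvd // => /dvdnP[c cE].
  have -> : psize p + k - r.+1 = c * k + k.-1 by lia.
  by rewrite modnMDl modn_small //; lia.
(* If [psize p < r], then [k] would divide [r - psize p], which lies strictly between [0] and
   [k]. *)
move: pr; rewrite eq_sym eqn_mod_dvd; last by lia.
by move=> /dvdn_leq; lia.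
Qed.

Lemma residue_last (p : part) : 0 < psize p ->
  (exists2 c, 1 <= c <= r & psize p = c %[mod k]) <-> k - r <= residue p.
Proof.
move=> p0; have pE := level_residue p0; have sk := residue_lt p.
split=> [[c /andP[c1 cr] cE]|rs].
  have : psize p + (k - r.+1 + (r == k)) = c + (k - r.+1 + (r == k)) %[mod k].
    by rewrite -modnDml cE modnDml.
  (* For [r = k] the bound [k - r] is [0]; otherwise [c + (k - r.+1) < k], so this sum is its own
     remainder. *)
  have [rk|rk] := eqVneq r k; first by lia.
  have -> : psize p + (k - r.+1 + 0) = psize p + k - r.+1 by lia.
  by rewrite -/(residue p) => ->; rewrite modn_small; lia.
exists (residue p + r.+1 - k); first by lia.
have -> : psize p = level p * k + (residue p + r.+1 - k) by lia.
by rewrite modnMDl.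
Qed.

(** * Modulo overpartitions and basis elements as chains of steps *)

Definition overlined_ok (p : part) : bool :=
  (0 < psize p) && (overlined p ==> (residue p == k.-1)).

Definition modulo_step (p q : part) : bool :=
  part_step p q && (overlined q || (residue q <= residue p)).

Definition basis_step (p q : part) : bool :=
  part_step p q && (level p == level q + overlined q).

Lemma overlined_okP (s : seq part) :
  all (fun p => 0 < psize p) s /\ only_overlined k r s <-> all overlined_ok s.
Proof.
split=> [[pos ok]|ok].
  apply/allP => p ps; rewrite /overlined_ok (allP pos) //=.
  apply/implyP => po; apply/eqP/residue_overlined; first exact: (allP pos).
  exact: ok.
split; first by apply: sub_all ok => p /andP[].
move=> p /(allP ok) /andP[p0 /implyP po] /po /eqP rE.
have := level_residue p0; rewrite rE => pE.
have -> : psize p = level p * k + r by lia.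
by rewrite modnMDl.
Qed.

(** [phi] is [residue] up to a constant shift, so the condition on consecutive parts compares
    residues; the one on the last part is [residue_last]. *)
Lemma modulo_overpartitionP (p : part) (s : seq part) :
  modulo_overpartition k r (p :: s) <->
  [/\ all overlined_ok (p :: s), path modulo_step p s
    & k - r <= residue (last p s)].
Proof.
set t := p :: s.
have lastin : last p s \in t by exact: mem_last.
have nthpos : all (fun p => 0 < psize p) t -> forall i, i < size t ->
    0 < psize (nth (plain_part 0) t i).
  by move=> pos i it; apply: (allP pos); rewrite mem_nth.
split.
- move=> [[ov ok] lst st]; case/overpartitionP: ov => pos stp.
  split; first exact/overlined_okP.
    change (sorted modulo_step t); rewrite sorted_and stp andTb.
    apply/(sortedP (plain_part 0)) => i it.
    have [p0 q0] := (nthpos pos i (ltnW it), nthpos pos _ it).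
    have := st i it; rewrite !phi_residue // => {}st.
    case: leqP => [|rlt]; first by rewrite orbT.
    by rewrite orbF; apply: st; lia.
  by apply/residue_last; [exact: (allP pos)|exact: lst].
- move=> [/overlined_okP[pos ok] stp lst].
  have := stp; rewrite -[path _ _ _]/(sorted modulo_step t) sorted_and.
  move=> /andP[st1 st2]; split.
  + by split=> //; apply/overpartitionP.
  + by move=> _; apply/residue_last => //; exact: (allP pos).
  + move=> i it.
    have [p0 q0] := (nthpos pos i (ltnW it), nthpos pos _ it).
    rewrite !phi_residue // => lt.
    by case/orP: (sortedP (plain_part 0) st2 i it) => [//|le]; lia.
Qed.

(* The block of the parts between [over_part (k * (j - 1) + r)] and
   [plain_part (k * j + r)] is given by [j = level q + overlined q]. *)
Lemma basis_stepP (p q : part) : overlined_ok p -> overlined_ok q ->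
  part_step p q ->
  basis_step p q <->
  (forall j, (0 < j -> (over_part (k * j.-1 + r) <= q)%O) ->
     (q <= plain_part (k * j + r))%O -> (p <= over_part (k * j + r))%O).
Proof.
move=> /andP[p0 po] /andP[q0 qo] stp; rewrite /basis_step stp /=.
have pE := level_residue p0; have qE := level_residue q0.
have ps := residue_lt p; have qs := residue_lt q.
move: stp; rewrite /part_step => stp.
(* An overlined [q] has the largest residue [k.-1], so any larger size is at a higher level. *)
have lvl : level q + overlined q <= level p.
  by move: qo stp; case: (overlined q) => /= [/eqP|_]; nia.
split=> [/eqP lE j lo|H].
- rewrite !le_partE /psize /overlined /= -!/(psize _) -!/(overlined _).
  rewrite implybT andbT => hi.
  (* The parts up to [over_part (k * j + r)] are those of level at most [j]. *)
  suff: level p <= j by nia.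
  by rewrite lE; move: qo hi; case: (overlined q) => /= [/eqP qr|_] hi; nia.
- have := H (level q + overlined q).
  rewrite !le_partE /psize /overlined /= -!/(psize _) -!/(overlined _).
  rewrite implybT andbT => {}H.
  have {}H : (psize p < k * (level q + overlined q) + r)
      || (psize p == k * (level q + overlined q) + r).
    apply: H.
      move: qo; case: (overlined q) => /= [/eqP qr _|_]; first by nia.
      by rewrite addn0; case: (level q) qE => //= n qE _; nia.
    by move: qo; case: (overlined q) => /= [/eqP qr|_]; nia.
  by apply/eqP; nia.
Qed.

(** [basis_stepP] turns the block conditions into steps, and a last part bounded by [over_part r]
    has size at most [r], hence level [0]. *)
Lemma modulo_basisP (p : part) (s : seq part) :
  modulo_basis k r (p :: s) <->
  [/\ all overlined_ok (p :: s), path basis_step p s & level (last p s) = 0].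
Proof.
set t := p :: s.
have lastin : last p s \in t by exact: mem_last.
have lastE : all overlined_ok t ->
    (last p s <= over_part r)%O <-> level (last p s) = 0.
  move=> /allP/(_ _ lastin)/andP[l0 _].
  have := level_residue l0; have := residue_lt (last p s).
  rewrite le_partE /psize /overlined /= -!/(psize _) -!/(overlined _) implybT.
  by move=> ? ?; split; [nia|move=> lE; nia].
have nthok : all overlined_ok t -> forall i, i < size t ->
    overlined_ok (nth (plain_part 0) t i).
  by move=> ok i it; apply: (allP ok); rewrite mem_nth.
split.
- move=> [m /= m1 [ov szE ok lst st]]; case/overpartitionP: ov => pos stp.
  have okt : all overlined_ok t by exact/overlined_okP.
  split=> //; last exact/lastE.
  change (sorted basis_step t).
  apply/(sortedP (plain_part 0)) => i it.
  apply/(basis_stepP (nthok okt i (ltnW it)) (nthok okt _ it)).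
    exact: (sortedP (plain_part 0) stp).
  by move=> j; apply: st; rewrite -szE.
- move=> [okt stp lst]; exists (size t) => //.
  have [pos ok] := (overlined_okP t).2 okt.
  have := stp; rewrite -[path _ _ _]/(sorted basis_step t) sorted_and.
  move=> /andP[st1 st2]; split=> //; first exact/overpartitionP.
    exact/lastE.
  move=> i j it; apply: (basis_stepP (nthok okt i (ltnW it)) (nthok okt _ it) _).1.
    exact: (sortedP (plain_part 0) st1).
  exact: (sortedP (plain_part 0) (stp : sorted basis_step t)).
Qed.

(** * Steps in terms of levels and residues *)

(** If [q] is overlined, its residue is maximal and a larger size means a higher level; if not,
    [residue q <= residue p] makes the comparison of sizes one of levels. *)
Lemma modulo_stepE (p q : part) : overlined_ok p -> overlined_ok q ->
  modulo_step p q =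
  (level q + overlined q <= level p) && (overlined q || (residue q <= residue p)).
Proof.
move=> /andP[p0 po] /andP[q0 qo].
have pE := level_residue p0; have qE := level_residue q0.
have ps := residue_lt p; have qs := residue_lt q.
rewrite /modulo_step /part_step andbC [RHS]andbC.
by move: qo; case: (overlined q) => /= [/eqP|_]; nia.
Qed.

(** At equal levels sizes are ordered as residues, so [basis_step] already contains the residue
    condition of [modulo_step]. *)
Lemma basis_stepE (p q : part) : overlined_ok p -> overlined_ok q ->
  basis_step p q =
  (level p == level q + overlined q) && (overlined q || (residue q <= residue p)).
Proof.
move=> /andP[p0 po] /andP[q0 qo].
have pE := level_residue p0; have qE := level_residue q0.
have ps := residue_lt p; have qs := residue_lt q.
rewrite /basis_step /part_step andbC; case: eqP => //= lE.
by move: qo lE; case: (overlined q) => /= [/eqP|_]; nia.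
Qed.

Lemma basis_level (p : part) (s : seq part) :
  path basis_step p s -> level (last p s) = 0 -> level p = count overlined s.
Proof.
elim: s p => //= q s IHs p /andP[/andP[_ /eqP ->] ps] /(IHs _ ps) ->.
by rewrite addnC.
Qed.

(** The lower bounds on the level drops add up. Hence the differences in [excess] and [reduction]
    are not truncated. *)
Lemma modulo_level (p : part) (s : seq part) :
  all overlined_ok (p :: s) -> path modulo_step p s ->
  count overlined s <= level p.
Proof.
elim: s p => //= q s IHs p /and3P[pok qok sok] /andP[pq ps].
move: pq; rewrite modulo_stepE // => /andP[pq _].
by have /= := IHs q; rewrite qok sok ps => /(_ isT isT); lia.
Qed.

(** * Splitting a modulo overpartition into a basis element and multiples of [k] *)

Fixpoint excess (s : seq part) : seq nat :=
  if s is p :: s' then k * (level p - count overlined s') :: excess s' else [::].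

Fixpoint reduction (s : seq part) : seq part :=
  if s is p :: s' then
    (psize p - k * (level p - count overlined s'), overlined p) :: reduction s'
  else [::].

Lemma size_excess (s : seq part) : size (excess s) = size s.
Proof. by elim: s => //= p s ->. Qed.

Lemma size_reduction (s : seq part) : size (reduction s) = size s.
Proof. by elim: s => //= p s ->. Qed.

Lemma excess_dvd (s : seq part) : all (dvdn k) (excess s).
Proof. by elim: s => //= p s ->; rewrite dvdn_mulr. Qed.

(** From [p] to the next part [q] the level falls by at least [overlined q], and the number of later
    overlined parts by exactly that. *)
Lemma excess_sorted (p : part) (s : seq part) :
  all overlined_ok (p :: s) -> path modulo_step p s ->
  sorted geq (excess (p :: s)).
Proof.
elim: s p => //= q s IHs p /and3P[pok qok sok] /andP[pq ps].
move: pq; rewrite modulo_stepE // => /andP[pq _].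
have /= := IHs q; rewrite qok sok ps => -> //.
by rewrite andbT leq_mul2l; apply/orP; right; lia.
Qed.

(** At level [0] a size is positive only if the residue is at least [k - r], at higher levels
    always; hence the disjunction. *)
Lemma level_residue_reduce (p : part) (n : nat) : n <= level p ->
  0 < psize p -> 0 < n \/ k - r <= residue p ->
  let p' : part := (psize p - k * (level p - n), overlined p) in
  [/\ psize p = psize p' + k * (level p - n), 0 < psize p',
      level p' = n & residue p' = residue p].
Proof.
move=> np p0 n0 p'.
have pE := level_residue p0; have ps := residue_lt p.
have szE : psize p' = psize p - k * (level p - n) by [].
have [n' lE] : exists n', level p = n + n' by exists (level p - n); lia.
have nE : level p - n = n' by lia.
rewrite nE in szE *.
have le : k * n' < psize p by case: n0 => [n0|n0]; nia.
have [lE' rE'] : level p' = n /\ residue p' = residue p.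
  by apply: level_residue_unique => //; nia.
by split=> //; lia.
Qed.

(** Without overlined parts after [p] the residues never increase along the list, so the bound on
    the last one holds for [p]. This supplies the disjunction in [level_residue_reduce]. *)
Lemma modulo_residue (p : part) (s : seq part) :
  all overlined_ok (p :: s) -> path modulo_step p s ->
  k - r <= residue (last p s) -> 0 < count overlined s \/ k - r <= residue p.
Proof.
elim: s p => [|q s IHs] p; first by right.
rewrite [all _ _]/= => /and3P[pok qok sok] /andP[].
rewrite modulo_stepE // => /andP[_ pq] ps lst.
have := IHs q; rewrite /= qok sok => /(_ isT ps lst).
by move: pq; case: (overlined q) => /=; lia.
Qed.

Lemma reductionP (p : part) (s : seq part) :
  modulo_overpartition k r (p :: s) ->
  modulo_basis k r (reduction (p :: s)) /\
  add_to_parts (reduction (p :: s)) (excess (p :: s)) = p :: s.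
Proof.
move=> /modulo_overpartitionP[ok stp lst].
rewrite [reduction _]/=; set p' : part := (_, _).
suff [H1 H2 H3 H4] : [/\ all overlined_ok (p' :: reduction s),
    path basis_step p' (reduction s), level (last p' (reduction s)) = 0
  & add_to_parts (p' :: reduction s) (excess (p :: s)) = p :: s].
  by split=> //; apply/modulo_basisP.
(* Stated for an arbitrary list, since the induction step needs it at both [p] and [q]. *)
have head t u : all overlined_ok (t :: u) -> path modulo_step t u ->
    k - r <= residue (last t u) ->
    let n := count overlined u in
    let t' : part := (psize t - k * (level t - n), overlined t) in
    [/\ add_to_part t' (k * (level t - n)) = t, overlined_ok t',
      level t' = n & residue t' = residue t].
  move=> oku stpu lstu n t'; have /andP[/andP[t0 to] _] := oku.
  have [szE t'0 lE rE] := level_residue_reduce (modulo_level oku stpu) t0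
    (modulo_residue oku stpu lstu).
  split=> //; last by rewrite /overlined_ok t'0 rE.
  by rewrite /add_to_part -szE; exact/esym/surjective_pairing.
elim: s p ok stp lst @p' => [|q s IHs] p ok stp lst p'.
  have [pE pok lE rE] := head p [::] ok stp lst.
  by split=> //; [rewrite /= pok|rewrite /add_to_parts /= pE].
have [pE p'ok plE prE] := head _ _ ok stp lst.
have /andP[pok okq] := ok; have /andP[qok _] := okq.
have /andP[pq qs] := stp.
have [qE q'ok qlE qrE] := head _ _ okq qs lst.
have [IH1 IH2 IH3 IH4] := IHs q okq qs lst.
split.
- by rewrite [reduction _]/= [all _ _]/= p'ok.
- rewrite [reduction _]/= [path _ _ _]/= IH2 andbT.
  rewrite basis_stepE // plE qlE prE qrE /= addnC eqxx /=.
  by move: pq; rewrite modulo_stepE // => /andP[].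
- exact: IH3.
- by rewrite [reduction _]/= [excess _]/= add_to_parts_cons IH4 pE.
Qed.

(** * Uniqueness of the splitting, and closure under adding multiples of [k] *)

(** The sum determines both summands: overlines are untouched by the addition and [basis_level]
    gives the original levels, so the excess levels are exactly those added. *)
Lemma reduction_add (p : part) (l : seq part) (mu : seq nat) :
  modulo_basis k r (p :: l) -> size mu = size (p :: l) -> all (dvdn k) mu ->
  reduction (add_to_parts (p :: l) mu) = p :: l /\
  excess (add_to_parts (p :: l) mu) = mu.
Proof.
move=> /modulo_basisP[].
elim: l p mu => [|q l IHl] p [|c mu] // ok stp lst [szE] /andP[/dvdnP[n ->] dvd].
  have /andP[/andP[p0 _] _] := ok.
  case: mu szE dvd => // _ _; rewrite /= mulnC.
  have [-> _] := level_residue_add n p0; rewrite lst /= subn0.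
  by rewrite /add_to_part /psize /overlined /= addnK; case: (p).
have /andP[/andP[p0 _] okq] := ok.
have lE := basis_level stp lst.
have /andP[_ ql] := stp.
have [IH1 IH2] := IHl q mu okq ql lst szE dvd.
rewrite add_to_parts_cons /= -/(reduction _) -/(excess _) IH1 IH2.
rewrite count_overlined_add // mulnC.
have [-> _] := level_residue_add n p0; rewrite lE addKn.
by rewrite /add_to_part /psize /overlined /= addnK; case: (p).
Qed.

(** A non-increasing [mu] can only widen the level gaps, while residues and overlines stay. *)
Lemma modulo_add (p : part) (l : seq part) (mu : seq nat) :
  modulo_basis k r (p :: l) -> multiples k (size (p :: l)) mu ->
  modulo_overpartition k r (add_to_parts (p :: l) mu).
Proof.
move=> /modulo_basisP[ok stp lst] [].
have addok t n : overlined_ok t -> overlined_ok (add_to_part t (k * n)).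
  move=> /andP[t0 to]; have [_ rE] := level_residue_add n t0.
  by rewrite /overlined_ok rE to andbT ltn_addr.
case: mu => [//|c mu] szE srt dvd.
rewrite add_to_parts_cons; apply/modulo_overpartitionP.
elim: l p c mu ok stp lst szE srt dvd => [|q l IHl] p c mu ok stp lst [szE].
  case: mu szE => // _ _ /andP[/dvdnP[n ->] _]; rewrite mulnC.
  have /andP[pok _] := ok; have /andP[p0 _] := pok.
  split=> //; first by rewrite [all _ _]/= addok.
  have [_ /= ->] := level_residue_add n p0.
  (* A positive size at level [0] has residue at least [k - r]. *)
  by have := level_residue p0; rewrite /= in lst; rewrite lst; lia.
case: mu szE => [//|d mu] [szE] /andP[cd srt] /andP[kc dvd].
have /andP[pok okq] := ok; have /andP[qok _] := okq.
have /andP[pq ql] := stp.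
have [p0 q0] : 0 < psize p /\ 0 < psize q by move: pok qok => /andP[-> _] /andP[].
have [IH1 IH2 IH3] := IHl q d mu okq ql lst (congr1 S szE) srt dvd.
move: (kc) (dvd) cd IH1 IH2 IH3.
move=> /dvdnP[n ->] /andP[/dvdnP[n' ->] _]; rewrite ![_ * k]mulnC => cd IH1 IH2 IH3.
rewrite add_to_parts_cons; split; last exact: IH3.
  by rewrite [all _ _]/= addok.
rewrite [path _ _ _]/= IH2 andbT modulo_stepE ?addok //.
have [-> ->] := level_residue_add n p0; have [-> ->] := level_residue_add n' q0.
move: pq; rewrite basis_stepE // => /andP[/eqP -> ->].
by move: cd; rewrite /geq /= leq_pmul2l // andbT -!/(overlined _); lia.
Qed.

Lemma modulo_basis_sub : modulo_basis k r `<=` modulo_overpartition k r.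
Proof.
move=> [|p l] Bl.
  by case: Bl => m /= m1 [_ /esym m0]; rewrite m0 in m1.
have -> : p :: l = add_to_parts (p :: l) (nseq (size (p :: l)) 0).
  elim: (p :: l) => //= q s {1}->; rewrite add_to_parts_cons.
  by rewrite /add_to_part addn0; case: (q).
apply: modulo_add => //; split; first by rewrite size_nseq.
  by rewrite /=; elim: (size l) => //= -[].
by rewrite all_nseq dvdn0 orbT.
Qed.

(** * Finiteness of the basis for each number of parts *)

(** The first part is the largest, and its level counts overlined parts, so that level is at most
    the length. *)
Lemma basis_psize (l : seq part) (q : part) :
  modulo_basis k r l -> q \in l -> psize q <= k * size l + r.
Proof.
case: l => // p l /modulo_basisP[ok stp lst].
have head : psize p <= k * size l + r.
  have /andP[/andP[p0 _] _] := ok.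
  have := level_residue p0; have := residue_lt p.
  by rewrite (basis_level stp lst); have := count_size overlined l; nia.
rewrite inE => /predU1P[->|ql]; first by rewrite (leq_trans head) //= mulnS; lia.
have : path part_step p l by apply: sub_path stp => a b /andP[].
rewrite (path_sortedE part_step_trans) => /andP[/allP/(_ _ ql)].
by rewrite /part_step /= mulnS; lia.
Qed.

Lemma modulo_basis_finite (m : nat) :
  finite_set [set l | modulo_basis k r l /\ size l = m].
Proof.
pose N := (k * m + r).+1.
pose f (t : m.-tuple ('I_N * bool)) : seq part :=
  [seq (nat_of_ord x.1, x.2) : part | x <- t].
(* Sizes below [N] and flags form a finite type, so the lists in question are images of finitely
   many tuples. *)
apply: (@sub_finite_set _ _ (f @` setT)); last exact/finite_image/finite_finset.
move=> l [Bl szl].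
have szE : size [seq (inord (psize p) : 'I_N, overlined p) | p <- l] == m.
  by rewrite size_map szl.
exists (Tuple szE) => //; rewrite /f /= -map_comp.
rewrite -[RHS]map_id; apply/eq_in_map => p pl /=.
by rewrite inordK; [case: (p)|rewrite ltnS -szl; exact: basis_psize].
Qed.

Lemma modulo_basis_is_basis :
  is_basis k (modulo_overpartition k r) (modulo_basis k r).
Proof.
split=> [|m m1]; first exact: modulo_basis_sub.
split; first exact: modulo_basis_finite.
- move=> [|p s] Ms szE; first by rewrite -szE in m1.
  have [Bred addE] := reductionP Ms.
  have /modulo_overpartitionP[ok stp _] := Ms.
  exists (reduction (p :: s), excess (p :: s)); split.
    split=> //; first by rewrite size_reduction.
    split; [by rewrite size_excess|exact: excess_sorted|exact: excess_dvd].
  (* Any decomposition is recovered from its sum by [reduction] and [excess], so it equals the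
     chosen one. *)
  move=> [[|q l] mu] /= [Bl szl [szmu _ dvd] sE]; first by rewrite -szl in m1.
  have [rE eE] := reduction_add Bl (etrans szmu (esym szl)) dvd.
  by move: rE eE; rewrite -sE => <- <-.
- move=> [|p l] mu Bl szl; first by rewrite -szl in m1.
  by rewrite -szl; exact: modulo_add.
Qed.

End Levels.

Theorem theorem4p3 (k r : nat) (hr : (1 <= r)%N) (hkr : (r <= k)%N) :
  separable_overpartition_class k (modulo_overpartition k r) /\
  is_basis k (modulo_overpartition k r) (modulo_basis k r).
Proof.
have basis := modulo_basis_is_basis hr hkr.
by split=> //; split; [move=> s [[]]|exists (modulo_basis k r)].
Qed.
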